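(* Let $(A,V)$ and $(B,W)$ be permutation groups on finite sets, neither equal to $I_1$. Then $A\times B\in GR$ if and only if none of the following cases occurs: (i) $A\times B\notin DGR$, i.e. $A\notin DGR$ or $B\notin DGR$; (ii) either $A\in GR$, every Or-orbital of $A$ is self-paired, and $B\notin GR\cup\{I_2\}$; or $B\in GR$, every Or-orbital of $B$ is self-paired, and $A\notin GR\cup\{I_2\}$; (iii) $A,B\in DGR\setminus(GR\cup\{I_2\})$ are transitive, there exists $a\in A'=\bar{A}\setminus A$ which pairs every pair of distinct paired Or-orbitals of $A$, and there exists $b\in B'=\bar{B}\setminus B$ which pairs every pair of distinct paired Or-orbitals of $B$.
   Context: A permutation group $(A,V)$ is a group $A$ of permutations of a set $V$; $I_n$ denotes the trivial group acting on an $n$-element set; groups are considered up to permutation isomorphism. The direct product $A\times B$ acts on $V\times W$ by $(a,b)(x,y)=(a(x),b(y))$. An edge-colored graph on a set $U$ is a function $E$ from the 2-element subsets of $U$ to a finite set of colors, with automorphisms the permutations $\sigma$ of $U$ satisfying $E(\{\sigma(u),\sigma(u')\})=E(\{u,u'\})$ for all distinct $u,u'$; an edge-colored digraph is defined the same way with ordered pairs $(u,u')$, $u\neq u'$, in place of 2-element subsets. $GR$ (resp. $DGR$) is the class of permutation groups that equal the full automorphism group of some edge-colored graph (resp. digraph) on their underlying set. NOr-orbitals of $(A,V)$ are the orbits of $A$ on 2-element subsets of $V$; Or-orbitals are the orbits of $A$ on ordered pairs $(v,v')$ of distinct elements of $V$ under $a(v,v')=(a(v),a(v'))$. $\bar{A}$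 is the smallest permutation group on $V$ containing $A$ and belonging to $GR$ (equivalently, all permutations of $V$ mapping every NOr-orbital of $A$ onto itself); similarly for $\bar{B}$. Or-orbitals $O_1,O_2$ are paired if $O_2=\{(v',v):(v,v')\in O_1\}$; an Or-orbital is self-paired if paired with itself. A permutation $\sigma$ pairs $O_1$ and $O_2$ if $O_1\neq O_2$ are paired and $\sigma(O_1)=O_2$. *)

(* Defs.v *)
From mathcomp Require Import all_boot all_fingroup.

Set Implicit Arguments.
Unset Strict Implicit.
Unset Printing Implicit Defensive.

Import GroupScope.

(* A permutation group (A, V) is [A : {group {perm V}}] with [V : finType].
   The predicates below take sets of permutations, to which groups coerce. *)

(* (A, V) is permutation isomorphic to I_n. *)
Definition isI (n : nat) (V : finType) (A : {set {perm V}}) : Prop :=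
  #|V| = n /\ A = 1.

Section ProductAction.

Variables V W : finType.

Definition prod_fun (a : {perm V}) (b : {perm W}) (p : V * W) : V * W :=
  (a p.1, b p.2).

Lemma prod_fun_inj a b : injective (prod_fun a b).
Proof. by move=> [x y] [x' y'] [/perm_inj -> /perm_inj ->]. Qed.

Definition prod_perm (a : {perm V}) (b : {perm W}) : {perm V * W} :=
  perm (@prod_fun_inj a b).

Lemma prod_permE a b x y : prod_perm a b (x, y) = (a x, b y).
Proof. by rewrite permE. Qed.

Definition perm_dprod (A : {set {perm V}}) (B : {set {perm W}}) :
    {set {perm V * W}} :=
  [set prod_perm a b | a in A, b in B].

Lemma perm_dprod_group_set (A : {group {perm V}}) (B : {group {perm W}}) :
  group_set (perm_dprod A B).
Proof.
apply/group_setP; split.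
  apply/imset2P; exists 1 1; rewrite ?group1 //.
  by apply/permP=> -[x y]; rewrite prod_permE !perm1.
move=> _ _ /imset2P[a b aA bB ->] /imset2P[c d cA dB ->].
apply/imset2P; exists (a * c) (b * d); rewrite ?groupM //.
by apply/permP=> -[x y]; rewrite permM !prod_permE !permM.
Qed.

Canonical perm_dprod_group A B := Group (perm_dprod_group_set A B).

End ProductAction.

Section Classes.

Variable V : finType.
Implicit Type A : {set {perm V}}.

(* An edge-colored graph is a function on the 2-element subsets of V; it is
   represented by a total [E : {set V} -> C] which is only ever evaluated on
   sets [set u; u'] with u != u'. *)
Definition Aut_graph (C : finType) (E : {set V} -> C) : {set {perm V}} :=
  [set s : {perm V} | [forall u, forall u',
     (u != u') ==> (E [set s u; s u'] == E [set u; u'])]].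

(* Likewise, [E] is only evaluated on ordered pairs of distinct elements. *)
Definition Aut_digraph (C : finType) (E : V * V -> C) : {set {perm V}} :=
  [set s : {perm V} | [forall u, forall u',
     (u != u') ==> (E (s u, s u') == E (u, u'))]].

Definition GR A : Prop :=
  exists (C : finType) (E : {set V} -> C), A = Aut_graph E.

Definition DGR A : Prop :=
  exists (C : finType) (E : V * V -> C), A = Aut_digraph E.

Definition NOr_orbit A (e : {set V}) : {set {set V}} :=
  [set a @: e | a : {perm V} in A].

Definition NOr_orbitals A : {set {set {set V}}} :=
  [set NOr_orbit A e | e : {set V} in [set e : {set V} | #|e| == 2]].

Definition pair_act (s : {perm V}) (p : V * V) : V * V := (s p.1, s p.2).

Definition Or_orbit A (p : V * V) : {set V * V} :=
  [set pair_act a p | a in A].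

Definition Or_orbitals A : {set {set V * V}} :=
  [set Or_orbit A p | p in [set p : V * V | p.1 != p.2]].

(* The group written with a bar over A; [GR_closure_min] shows that it is the
   smallest permutation group that contains A and belongs to GR. *)
Definition GR_closure A : {set {perm V}} :=
  [set s : {perm V} | [forall O in NOr_orbitals A,
     [set s @: (e : {set V}) | e : {set V} in O] == O]].

Definition paired (O1 O2 : {set V * V}) : Prop :=
  O2 = [set (p.2, p.1) | p in O1].

Definition self_paired (O : {set V * V}) : Prop := paired O O.

Definition perm_pairs (s : {perm V}) (O1 O2 : {set V * V}) : Prop :=
  [/\ O1 <> O2, paired O1 O2 & [set pair_act s p | p in O1] = O2].

Definition all_self_paired A : Prop :=
  forall O, O \in Or_orbitals A -> self_paired O.

Definition pairs_all A (s : {perm V}) : Prop :=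
  forall O1 O2, O1 \in Or_orbitals A -> O2 \in Or_orbitals A ->
    O1 <> O2 -> paired O1 O2 -> perm_pairs s O1 O2.

Lemma imset_pair (s : {perm V}) u v : s @: [set u; v] = [set s u; s v].
Proof. by rewrite imsetU1 imset_set1. Qed.

Lemma Aut_graph_group_set (C : finType) (E : {set V} -> C) :
  group_set (Aut_graph E).
Proof.
apply/group_setP; split.
  by rewrite inE; apply/forallP=> u; apply/forallP=> v; rewrite !perm1 eqxx implybT.
move=> s t; rewrite !inE => /forallP hs /forallP ht.
apply/forallP=> u; apply/forallP=> v; apply/implyP=> uv; rewrite !permM.
have /forallP/(_ v)/implyP/(_ uv)/eqP <- := hs u.
have /forallP/(_ (s v))/implyP := ht (s u); apply.
by rewrite (inj_eq perm_inj).
Qed.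

Canonical Aut_graph_group C E := Group (@Aut_graph_group_set C E).

Lemma GR_closure_min (A : {group {perm V}}) :
  [/\ GR (GR_closure A), group_set (GR_closure A), A \subset GR_closure A &
      forall G : {group {perm V}}, GR G -> A \subset G -> GR_closure A \subset G].
Proof.
have im1 (e : {set V}) : (1 : {perm V}) @: e = e.
  by rewrite -[RHS]imset_id; apply: eq_imset => x; rewrite perm1.
have imM (s t : {perm V}) (e : {set V}) : (s * t) @: e = t @: (s @: e).
  by rewrite -imset_comp; apply: eq_imset => x; rewrite /= permM.
have orb_refl e : e \in NOr_orbit A e.
  by apply/imsetP; exists 1; rewrite ?group1 ?im1.
have orb_eq e f : f \in NOr_orbit A e -> NOr_orbit A f = NOr_orbit A e.
  case/imsetP=> a aA ->; apply/setP=> g; apply/imsetP/imsetP=> -[b bA ->].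
    by exists (a * b); rewrite ?groupM ?imM.
  by exists (a^-1 * b); rewrite ?groupM ?groupV // -!imM mulKVg.
have clE s : (s \in GR_closure A) <->
    (forall e : {set V}, #|e| = 2 -> s @: e \in NOr_orbit A e).
  rewrite inE; split.
    move=> /forall_inP h e e2.
    have /h/eqP <- : NOr_orbit A e \in NOr_orbitals A.
      by apply: imset_f; rewrite inE e2.
    exact: imset_f.
  move=> h; apply/forall_inP=> O /imsetP[e]; rewrite inE => /eqP e2 ->{O}.
  rewrite eqEcard; apply/andP; split; last first.
    have injs : injective (fun f : {set V} => s @: f).
      apply: (can_inj (g := fun f : {set V} => s^-1 @: f)) => f.
      by rewrite -imM mulgV im1.
    by rewrite (card_imset _ injs).
  apply/subsetP=> _ /imsetP[f fe ->]; rewrite -(orb_eq _ _ fe); apply: h.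
  by case/imsetP: fe => a _ ->; rewrite card_imset //; apply: perm_inj.
have clA : GR_closure A = Aut_graph (NOr_orbit A).
  apply/setP=> s; apply/idP/idP.
    move=> /clE h; rewrite inE; apply/forallP=> u; apply/forallP=> v.
    apply/implyP=> uv; rewrite -imset_pair; apply/eqP/orb_eq/h.
    by rewrite cards2 uv.
  rewrite inE => /forallP h; apply/clE=> e e2.
  have /cards2P[u [v [uv ->]]] : #|e| == 2 by rewrite e2.
  have /forallP/(_ v)/implyP/(_ uv)/eqP <- := h u.
  by rewrite imset_pair.
split.
- by exists {set {set V}}, (NOr_orbit A).
- by rewrite clA Aut_graph_group_set.
- apply/subsetP=> a aA; apply/clE=> e _; exact: imset_f.
move=> G [C [E ->]] /subsetP AG; apply/subsetP=> s /clE h.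
rewrite inE; apply/forallP=> u; apply/forallP=> v; apply/implyP=> uv.
have /imsetP[a /AG] : s @: [set u; v] \in NOr_orbit A [set u; v].
  by apply: h; rewrite cards2 uv.
rewrite inE !imset_pair => /forallP/(_ u)/forallP/(_ v)/implyP/(_ uv)/eqP.
by move=> <- ->.
Qed.

End Classes.

(* Main.v *)
Require Import Defs.
From mathcomp Require Import all_boot all_fingroup.
Import GroupScope.

(** Every permutation that preserves the NOr-orbitals of [A x B] preserves the
    relations "same first coordinate" and "same second coordinate", hence is a
    product [(f, g)].  Such a product keeps or flips the Or-orbital of each
    pair, and on a pair of pairs both factors must keep or both must flip.  So
    if [f] moves outside [A] (it flips some Or-orbital that it does not keep),
    then [g] flips every Or-orbital of [B], and symmetrically.  When [g] is in
    [B], this says that all Or-orbitals of [B] are self-paired, which is case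
    (ii); when neither factor is in its group, it is case (iii). *)

Set Implicit Arguments.
Unset Strict Implicit.
Unset Printing Implicit Defensive.

(** * Or-orbitals of a single group, and membership in [GR] and [DGR] *)

Section Orbitals.

Variables (V : finType) (A : {group {perm V}}).
Implicit Types (s : {perm V}) (u v x y : V).

Lemma Or_orbitP x y u v :
  reflect (exists2 a, a \in A & a x = u /\ a y = v)
          ((u, v) \in Or_orbit A (x, y)).
Proof.
apply: (iffP imsetP) => -[a aA]; first by case=> -> ->; exists a.
by case=> <- <-; exists a.
Qed.

Lemma Or_orbit_refl p : p \in Or_orbit A p.
Proof. by case: p => x y; apply/Or_orbitP; exists 1; rewrite ?perm1. Qed.

Lemma Or_orbit_eq p q : p \in Or_orbit A q -> Or_orbit A p = Or_orbit A q.
Proof.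
case: p q => [u v] [x y] /Or_orbitP[a aA [<- <-]].
apply/setP=> -[z t]; apply/Or_orbitP/Or_orbitP=> -[b bA [<- <-]].
  by exists (a * b); rewrite ?groupM ?permM.
by exists (a^-1 * b); rewrite ?groupM ?groupV ?permM ?permK.
Qed.

Lemma Or_orbit_swap x y u v :
  ((v, u) \in Or_orbit A (y, x)) = ((u, v) \in Or_orbit A (x, y)).
Proof. by apply/Or_orbitP/Or_orbitP=> -[a aA [<- <-]]; exists a. Qed.

Lemma Or_orbit_diag u v : ((v, v) \in Or_orbit A (u, u)) = (v \in orbit 'P A u).
Proof.
apply/Or_orbitP/orbitP=> -[a aA]; first by case=> <-; exists a.
by move=> <-; exists a.
Qed.

Lemma Or_orbit_fst x y u v :
  (u, v) \in Or_orbit A (x, y) -> u \in orbit 'P A x.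
Proof. by case/Or_orbitP=> a aA [<- _]; apply: mem_orbit. Qed.

Lemma Or_orbit_snd x y u v :
  (u, v) \in Or_orbit A (x, y) -> v \in orbit 'P A y.
Proof. by case/Or_orbitP=> a aA [_ <-]; apply: mem_orbit. Qed.

(** The case [u = v] is deliberately allowed: there both notions say that [s] moves [u] inside its
    [A]-orbit. Distinct points of a product may share a coordinate, so such diagonal pairs do
    occur. *)
Definition keeps s u v := (s u, s v) \in Or_orbit A (u, v).
Definition flips s u v := (s u, s v) \in Or_orbit A (v, u).

Lemma keeps_mem s u v : s \in A -> keeps s u v.
Proof. by move=> sA; apply/Or_orbitP; exists s. Qed.

Lemma flips_diag s u : flips s u u = keeps s u u.
Proof. by []. Qed.

Lemma keeps_diag s u v : keeps s u v -> keeps s u u.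
Proof. by rewrite /keeps Or_orbit_diag; apply: Or_orbit_fst. Qed.

Lemma reversed_Or_orbit u v :
  [set (p.2, p.1) | p in Or_orbit A (u, v)] = Or_orbit A (v, u).
Proof.
apply/setP=> -[x y]; apply/imsetP/idP.
  by case=> -[z t] ? [-> ->]; rewrite Or_orbit_swap.
by rewrite -Or_orbit_swap => ?; exists (y, x).
Qed.

Lemma all_self_pairedE :
  all_self_paired A <-> (forall u v, (v, u) \in Or_orbit A (u, v)).
Proof.
split=> [h u v | h O].
  have [-> | uv] := eqVneq u v; first exact: Or_orbit_refl.
  have /h : Or_orbit A (u, v) \in Or_orbitals A by apply: imset_f; rewrite inE.
  by rewrite /self_paired /paired reversed_Or_orbit => ->; apply: Or_orbit_refl.
case/imsetP=> -[u v] _ ->.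
by rewrite /self_paired /paired reversed_Or_orbit; apply: Or_orbit_eq.
Qed.

(** If [a] maps the set [[set u; v]] onto [[set s u; s v]], it matches the points either in order
    ([s] keeps the pair) or crosswise ([s] flips it). *)
Lemma mem_GR_closureP s :
  reflect (forall u v, u != v -> keeps s u v || flips s u v)
          (s \in GR_closure A).
Proof.
have [GRc _ Ac minc] := GR_closure_min A.
apply: (iffP idP) => [sc u v uv | h].
  have orbE (a : {perm V}) (e : {set V}) : a \in A -> NOr_orbit A (a @: e) = NOr_orbit A e.
    move=> aA; apply/setP=> d; apply/imsetP/imsetP=> -[b bA ->].
      exists (a * b); rewrite ?groupM // -imset_comp.
      by apply: eq_imset => x; rewrite /= permM.
    exists (a^-1 * b); rewrite ?groupM ?groupV // -imset_comp.
    by apply: eq_imset => x; rewrite /= permM permK.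
  have AE : A \subset Aut_graph_group (NOr_orbit A).
    apply/subsetP=> a aA; rewrite inE.
    apply/forallP=> x; apply/forallP=> y; apply/implyP=> _.
    by rewrite -imset_pair orbE.
  have : s \in Aut_graph_group (NOr_orbit A).
    by apply: (subsetP (minc _ _ AE)) sc; exists {set {set V}}, (NOr_orbit A).
  rewrite inE => /forallP/(_ u)/forallP/(_ v)/implyP/(_ uv)/eqP h.
  have : [set s u; s v] \in NOr_orbit A [set u; v].
    rewrite -h; apply/imsetP; exists 1; rewrite ?group1 //.
    by rewrite imset_pair !perm1.
  case/imsetP=> a aA; rewrite imset_pair => e.
  have: s u \in [set a u; a v] by rewrite -e set21.
  have: s v \in [set a u; a v] by rewrite -e set22.
  have suv : s u != s v by rewrite (inj_eq perm_inj).
  move: suv; rewrite !inE.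
  move=> suv /pred2P[] ev /pred2P[] eu; move: suv; rewrite eu ev ?eqxx //= => _.
    by apply/orP; right; apply/Or_orbitP; exists a.
  by apply/orP; left; apply/Or_orbitP; exists a.
(* The closure is the automorphism group of a coloring [E]; [A] preserves [E], and [E] does not see
   the order of a pair. *)
case: GRc Ac => C [E ->] /subsetP Ac; rewrite inE.
apply/forallP=> u; apply/forallP=> v; apply/implyP=> uv.
case/orP: (h u v uv) => /Or_orbitP[a /Ac]; rewrite inE.
  by move=> /forallP/(_ u)/forallP/(_ v)/implyP/(_ uv) ea [<- <-].
by move=> /forallP/(_ u)/forallP/(_ v)/implyP/(_ uv) ea [<- <-]; rewrite setUC.
Qed.

Lemma GRP : reflect (GR A) (GR_closure A \subset A).
Proof.
have [GRc _ Ac minc] := GR_closure_min A.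
apply: (iffP idP) => [cA | /minc]; last exact.
by rewrite -(_ : GR_closure A = A) //; apply/eqP; rewrite eqEsubset cA.
Qed.

(** The directed analogue of being equal to one's closure. The boolean form makes membership in
    [DGR] decidable, which the classical steps of the main proof rely on. *)
Definition DGR_closed :=
  [forall s : {perm V},
    [forall u, forall v, (u != v) ==> keeps s u v] ==> (s \in A)].

Lemma DGR_closedP :
  reflect (forall s, (forall u v, u != v -> keeps s u v) -> s \in A) DGR_closed.
Proof.
apply: (iffP forallP) => h s.
  move=> k; apply: (implyP (h s)); apply/forallP=> u; apply/forallP=> v.
  by apply/implyP/k.
apply/implyP=> /forallP k; apply: h => u v uv.
by have /forallP/(_ v)/implyP := k u; apply.
Qed.

(** Coloring each pair by its own Or-orbital gives the finest coloring that [A] preserves; any other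
    one is constant on Or-orbitals. *)
Lemma DGRP : reflect (DGR A) DGR_closed.
Proof.
apply: (iffP DGR_closedP) => [h | [C [E AE]] s k].
  exists {set V * V}, (Or_orbit A); apply/setP=> s; rewrite inE.
  apply/idP/idP=> [sA | /forallP k].
    apply/forallP=> u; apply/forallP=> v; apply/implyP=> _.
    exact/eqP/Or_orbit_eq/keeps_mem.
  apply: h => u v uv; have /forallP/(_ v)/implyP/(_ uv)/eqP := k u.
  by rewrite /keeps => <-; apply: Or_orbit_refl.
rewrite AE inE; apply/forallP=> u; apply/forallP=> v; apply/implyP=> uv.
case/Or_orbitP: (k u v uv) => a; rewrite AE inE.
by move=> /forallP/(_ u)/forallP/(_ v)/implyP/(_ uv) ea [<- <-].
Qed.

Lemma GR_DGR : GR A -> DGR A.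
Proof.
move=> /GRP/subsetP cA; apply/DGRP/DGR_closedP=> s k; apply: cA.
by apply/mem_GR_closureP=> u v uv; rewrite k.
Qed.

Lemma self_paired_GR : DGR A -> all_self_paired A -> GR A.
Proof.
move=> /DGRP/DGR_closedP cA /all_self_pairedE sp; apply/GRP/subsetP=> s.
move=> /mem_GR_closureP h; apply: cA => u v /h/orP[] //.
by rewrite /keeps /flips (Or_orbit_eq (sp u v)).
Qed.

(* [I_2] is excluded because the transposition is in its closure. *)
Lemma GR_closure_keeps_diag s u :
  ~ isI 2 A -> s \in GR_closure A -> keeps s u u.
Proof.
move=> nI2 /mem_GR_closureP h; apply/negPn/negP=> nk; apply: nI2.
have su : s u \notin orbit 'P A u by move: nk; rewrite /keeps Or_orbit_diag.
have flip v : v != u -> flips s u v.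
  rewrite eq_sym => /h/orP[/keeps_diag | //]; by rewrite (negPf nk).
(* If [a u] differed from [u], flipping [(u, a u)] would put [s u] in the orbit of [a u], which is
   that of [u]. *)
have fixu a : a \in A -> a u = u.
  move=> aA; apply/eqP/negPn/negP=> /flip/Or_orbit_fst.
  rewrite (_ : orbit 'P A (a u) = orbit 'P A u) ?(negPf su) //.
  by apply/orbit_eqP/mem_orbit.
(* The orbit of [u] is now a singleton, so [s] sends every other point to [u]; by injectivity there
   is only one other point. *)
have sv v : v != u -> s v = u.
  by move=> /flip/Or_orbit_snd/orbitP[a aA <-]; apply: fixu.
have suu : s u != u by apply: contraNneq su => {1}->; apply: orbit_refl.
have VE : [set: V] = [set u; s u].
  apply/setP=> v; rewrite in_setT in_set2; have [//|vu /=] := eqVneq v u.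
  by rewrite -(inj_eq (@perm_inj _ s)) (sv v) ?(sv (s u)) ?eqxx.
split; first by rewrite -cardsT VE cards2 eq_sym suu.
apply/eqP; rewrite eqEsubset sub1G andbT; apply/subsetP=> a aA.
rewrite inE; apply/eqP/permP=> v; rewrite perm1.
have: v \in [set u; s u] by rewrite -VE inE.
case/set2P=> ->; first exact: fixu.
have: a (s u) \in [set u; s u] by rewrite -VE inE.
case/set2P=> // e; case/eqP: suu; apply: (@perm_inj _ a).
by rewrite e fixu.
Qed.

(** Flipping [(u0, v)] puts [s u0] in the orbit of [v], while keeping [(u0, u0)] puts it in the
    orbit of [u0]. *)
Lemma flips_trans s :
    (0 < #|V|)%N -> (forall u, keeps s u u) ->
    (forall u v, u != v -> flips s u v) ->
  [transitive A, on [set: V] | 'P].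
Proof.
case/card_gt0P=> u0 _ k f; apply/imsetP; exists u0 => //; apply/setP=> v.
rewrite inE; apply/esym.
have [<- | uv] := eqVneq u0 v; first exact: orbit_refl.
have := Or_orbit_fst (f _ _ uv); have := Or_orbit_fst (k u0).
by move=> /orbit_eqP <- /orbit_eqP ->; apply: orbit_refl.
Qed.

Lemma flips_pairs_all s :
  (forall u v, u != v -> flips s u v) -> pairs_all A s.
Proof.
move=> f O1 O2 /imsetP[[u v]]; rewrite inE /= => uv -> _ n12 p12; split=> //.
(* The image of [O1] under [s] and the reversal of [O1] have the same size, so one inclusion is
   enough. *)
rewrite p12; apply/eqP; rewrite eqEcard; apply/andP; split; last first.
  have act_inj : injective (pair_act s).
    by move=> [x y] [z t] [/perm_inj-> /perm_inj->].
  have rev_inj : injective (fun p : V * V => (p.2, p.1)).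
    by move=> [x y] [z t] [-> ->].
  by rewrite (card_imset _ act_inj) (card_imset _ rev_inj).
rewrite reversed_Or_orbit; apply/subsetP=> _ /imsetP[[x y] xyO ->].
have xy : x != y.
  by case/Or_orbitP: xyO => a _ [<- <-]; rewrite (inj_eq perm_inj).
have := f x y xy; rewrite /flips (@Or_orbit_eq (y, x) (v, u)) //.
by rewrite Or_orbit_swap.
Qed.

(** On a self-paired Or-orbital keeping and flipping coincide, so membership in the closure
    suffices; elsewhere the pairing hypothesis applies. *)
Lemma pairs_all_flips s u v :
  s \in GR_closure A -> pairs_all A s -> u != v -> flips s u v.
Proof.
move=> /mem_GR_closureP h ps uv.
have O1 : Or_orbit A (u, v) \in Or_orbitals A by apply: imset_f; rewrite inE.
have O2 : Or_orbit A (v, u) \in Or_orbitals A.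
  by apply: imset_f; rewrite inE eq_sym.
have [e | /eqP ne] := eqVneq (Or_orbit A (u, v)) (Or_orbit A (v, u)).
  by have := h u v uv; rewrite /keeps /flips e orbb.
have [|_ _ e] := ps _ _ O1 O2 ne; first by rewrite /paired reversed_Or_orbit.
rewrite /flips -e; apply/imsetP; exists (u, v) => //; exact: Or_orbit_refl.
Qed.

Lemma not_I1_pair :
  (0 < #|V|)%N -> ~ isI 1 A -> exists u v, u != v.
Proof.
case/card_gt0P=> u _ nI.
have [/existsP[v uv] | /existsPn h] := boolP [exists v, u != v]; first by exists u, v.
have V1 v : v = u by apply/eqP; rewrite eq_sym; apply/negPn/h.
case: nI; split.
  by rewrite -cardsT -(cards1 u); apply: eq_card => v; rewrite !inE (V1 v) eqxx.
apply/eqP; rewrite eqEsubset sub1G andbT; apply/subsetP=> a _.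
by rewrite inE; apply/eqP/permP=> v; rewrite perm1 (V1 v) (V1 (a u)).
Qed.

Lemma trans_keeps_diag s u :
  [transitive A, on [set: V] | 'P] -> keeps s u u.
Proof. by move=> tA; rewrite /keeps Or_orbit_diag (atransP tA). Qed.

Lemma not_mem_not_keeps s :
  DGR A -> s \notin A -> exists u v, ~~ keeps s u v.
Proof.
move=> /DGRP/DGR_closedP cA sA.
have [/existsP[u /existsP[v k]] | h] :=
  boolP [exists u, exists v, ~~ keeps s u v]; first by exists u, v.
case/negP: sA; apply: cA => u v _; move/existsPn/(_ u)/existsPn/(_ v): h.
by move/negPn.
Qed.

(** A group in [GR] contains its closure. If [A] were trivial, its orbits would be single points and
    [s] would be the identity, hence in [A]. *)
Lemma not_GR_or_I2 s :
    s \notin A -> s \in GR_closure A -> (forall u, keeps s u u) ->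
  ~ (GR A \/ isI 2 A).
Proof.
move=> sA sc k [/GRP/subsetP/(_ s sc) | [_ A1]]; first exact/negP.
case/negP: sA; rewrite A1 inE; apply/eqP/permP=> u; rewrite perm1.
by case/Or_orbitP: (k u) => a; rewrite A1 inE => /eqP -> []; rewrite perm1.
Qed.

End Orbitals.

(** * Keeping and flipping in a direct product *)

Section Product.

Variables (V W : finType) (A : {group {perm V}}) (B : {group {perm W}}).
Hypotheses (V_gt0 : (0 < #|V|)%N) (W_gt0 : (0 < #|W|)%N).

Let AB := perm_dprod_group A B.

Lemma mem_perm_dprod a b :
  (prod_perm a b \in perm_dprod A B) = (a \in A) && (b \in B).
Proof.
have [/card_gt0P[v0 _] /card_gt0P[w0 _]] := (V_gt0, W_gt0).
apply/imset2P/andP=> [[a' b' aA bB e] | [aA bB]]; last by exists a b.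
suff [-> ->] : a = a' /\ b = b' by [].
split; apply/permP.
  by move=> v; have := congr1 (fun s : {perm _} => (s (v, w0)).1) e; rewrite !prod_permE.
by move=> w; have := congr1 (fun s : {perm _} => (s (v0, w)).2) e; rewrite !prod_permE.
Qed.

Lemma Or_orbit_prod v w v' w' x y x' y' :
  (((v, w), (v', w')) \in Or_orbit AB ((x, y), (x', y')))
  = ((v, v') \in Or_orbit A (x, x')) && ((w, w') \in Or_orbit B (y, y')).
Proof.
apply/Or_orbitP/andP.
  case=> _ /imset2P[a b aA bB ->]; rewrite !prod_permE => -[[<- <-] [<- <-]].
  by split; apply/Or_orbitP; [exists a | exists b].
case=> /Or_orbitP[a aA [<- <-]] /Or_orbitP[b bB [<- <-]].
by exists (prod_perm a b); rewrite ?mem_perm_dprod ?aA // !prod_permE.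
Qed.

Lemma keeps_prod f g v w v' w' :
  keeps AB (prod_perm f g) (v, w) (v', w') = keeps A f v v' && keeps B g w w'.
Proof. by rewrite /keeps !prod_permE Or_orbit_prod. Qed.

Lemma flips_prod f g v w v' w' :
  flips AB (prod_perm f g) (v, w) (v', w') = flips A f v v' && flips B g w w'.
Proof. by rewrite /flips !prod_permE Or_orbit_prod. Qed.

(** For two points sharing a coordinate, the Or-orbit in that coordinate is diagonal, so their
    images share it as well, whether the pair is kept or flipped. The factors are then read off
    along the base points [v0] and [w0]. *)
Lemma GR_closure_prod s :
  s \in GR_closure AB -> exists f g, s = prod_perm f g.
Proof.
move=> /mem_GR_closureP h.
have [/card_gt0P[v0 _] /card_gt0P[w0 _]] := (V_gt0, W_gt0).
have diag (T : finType) (G : {group {perm T}}) x u v :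
    (u, v) \in Or_orbit G (x, x) -> u = v.
  by case/Or_orbitP=> a _ [<- <-].
have s1 v w w' : (s (v, w)).1 = (s (v, w')).1.
  have [-> // | ne] := eqVneq w w'.
  have /h : (v, w) != (v, w') by rewrite xpair_eqE eqxx.
  rewrite /keeps /flips; case: (s (v, w)) (s (v, w')) => [x y] [x' y'].
  by rewrite !Or_orbit_prod => /orP[] /andP[/diag].
have s2 v v' w : (s (v, w)).2 = (s (v', w)).2.
  have [-> // | ne] := eqVneq v v'.
  have /h : (v, w) != (v', w) by rewrite xpair_eqE eqxx andbT.
  rewrite /keeps /flips; case: (s (v, w)) (s (v', w)) => [x y] [x' y'].
  by rewrite !Or_orbit_prod => /orP[] /andP[_ /diag].
have f_inj : injective (fun v => (s (v, w0)).1).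
  move=> v v' /= e; suff /perm_inj[] : s (v, w0) = s (v', w0) by [].
  by rewrite [LHS]surjective_pairing e (s2 v v') -surjective_pairing.
have g_inj : injective (fun w => (s (v0, w)).2).
  move=> w w' /= e; suff /perm_inj[] : s (v0, w) = s (v0, w') by [].
  by rewrite [LHS]surjective_pairing e (s1 v0 w w') -surjective_pairing.
exists (perm f_inj), (perm g_inj); apply/permP=> -[v w].
by rewrite prod_permE !permE (s1 v w0 w) (s2 v0 v w) -surjective_pairing.
Qed.

Lemma DGR_prod :
    ~ isI 1 A -> ~ isI 1 B ->
  DGR (perm_dprod A B) <-> DGR A /\ DGR B.
Proof.
move=> /(not_I1_pair V_gt0)[v0 [v1 v01]] /(not_I1_pair W_gt0)[w0 [w1 w01]].
have other (T : finType) (x y u : T) : x != y -> exists z, u != z.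
  by have [-> | ux] := eqVneq u x; [exists y | exists x].
split=> [/(@DGRP _ AB)/DGR_closedP h | [/DGRP/DGR_closedP hA /DGRP/DGR_closedP hB]].
  split; apply/DGRP/DGR_closedP=> s k.
    (* Pairs with equal first coordinates need [keeps A s v v]; it follows from any off-diagonal
       pair [(v, z)], and [z] exists because [V] has two points. *)
    have : prod_perm s 1 \in AB.
      apply: h => -[v w] [v' w'] _; rewrite keeps_prod (keeps_mem _ _ (group1 B)) andbT.
      have [<- | /k //] := eqVneq v v'; have [z] := other _ _ _ v v01.
      by move/k/keeps_diag.
    by rewrite mem_perm_dprod => /andP[].
  have : prod_perm 1 s \in AB.
    apply: h => -[v w] [v' w'] _; rewrite keeps_prod (keeps_mem _ _ (group1 A)) /=.
    have [<- | /k //] := eqVneq w w'; have [z] := other _ _ _ w w01.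
    by move/k/keeps_diag.
  by rewrite mem_perm_dprod => /andP[].
apply/(@DGRP _ AB)/DGR_closedP=> s k.
have [|f [g es]] := @GR_closure_prod s.
  by apply/mem_GR_closureP=> u v uv; rewrite k.
rewrite {s}es in k *; rewrite mem_perm_dprod; apply/andP; split.
  apply: hA => v v' vv'; have /k : (v, w0) != (v', w0).
    by rewrite xpair_eqE eqxx andbT.
  by rewrite keeps_prod => /andP[].
apply: hB => w w' ww'; have /k : (v0, w) != (v0, w') by rewrite xpair_eqE eqxx.
by rewrite keeps_prod => /andP[].
Qed.

(** The tool for refuting [GR] in cases (ii) and (iii). Pairs sharing a coordinate need no joint
    condition, since keeping and flipping agree on the diagonal; hence [c] is assumed only when both
    coordinates differ. *)
Lemma GR_prod_closed f g :
    GR (perm_dprod A B) ->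
    (forall v, keeps A f v v) -> (forall w, keeps B g w w) ->
    f \in GR_closure A -> g \in GR_closure B ->
    (forall v v' w w', v != v' -> w != w' ->
       keeps A f v v' && keeps B g w w' || flips A f v v' && flips B g w w') ->
  (f \in A) && (g \in B).
Proof.
move=> /(@GRP _ AB)/subsetP h kf kg /mem_GR_closureP fc /mem_GR_closureP gc c.
rewrite -mem_perm_dprod; apply: h; apply/mem_GR_closureP=> -[v w] [v' w'].
rewrite keeps_prod flips_prod xpair_eqE.
have [<- /= ww' | vv' _] := eqVneq v v'; first by rewrite flips_diag kf gc.
have [<- /= | ww'] := eqVneq w w'; first by rewrite flips_diag kg !andbT fc.
exact: c.
Qed.

(** The element used is [(1, g)]: the identity both keeps and flips every pair of [V], so it agrees
    with whatever [g] does. *)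
Lemma GR_prod_self_pairedl :
  GR (perm_dprod A B) -> all_self_paired A -> ~ isI 2 B -> GR B.
Proof.
move=> h /all_self_pairedE sp nI; apply/GRP/subsetP=> g gc.
suff /andP[] : (1 \in A) && (g \in B) by [].
have k1 v v' : keeps A 1 v v' by rewrite keeps_mem.
apply: GR_prod_closed => // [w||v v' w w' vv' ww'].
- exact: GR_closure_keeps_diag.
- by apply/mem_GR_closureP=> v v' _; rewrite k1.
by rewrite k1 /flips !perm1 sp (mem_GR_closureP _ _ gc).
Qed.

Lemma GR_prod_self_pairedr :
  GR (perm_dprod A B) -> all_self_paired B -> ~ isI 2 A -> GR A.
Proof.
move=> h /all_self_pairedE sp nI; apply/GRP/subsetP=> f fc.
suff /andP[] : (f \in A) && (1 \in B) by [].
have k1 w w' : keeps B 1 w w' by rewrite keeps_mem.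
apply: GR_prod_closed => // [v||v v' w w' vv' ww'].
- exact: GR_closure_keeps_diag.
- by apply/mem_GR_closureP=> w w' _; rewrite k1.
by rewrite k1 /flips !perm1 sp !andbT (mem_GR_closureP _ _ fc).
Qed.

(** Converse to [GR_prod_closed]. Each factor has two distinct points; two points of the product
    differing only in one coordinate force the other factor to keep the diagonal pair. *)
Lemma GR_closure_prod_factors f g :
    ~ isI 1 A -> ~ isI 1 B -> prod_perm f g \in GR_closure AB ->
  [/\ f \in GR_closure A, g \in GR_closure B &
      forall v v' w w',
       keeps A f v v' && keeps B g w w' || flips A f v v' && flips B g w w'].
Proof.
move=> /(not_I1_pair V_gt0)[v0 [v1 v01]] /(not_I1_pair W_gt0)[w0 [w1 w01]].
move=> /mem_GR_closureP h.
have c v v' w w' : (v, w) != (v', w') ->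
   keeps A f v v' && keeps B g w w' || flips A f v v' && flips B g w w'.
  by move/h; rewrite keeps_prod flips_prod.
have kf v : keeps A f v v.
  have /c : (v, w0) != (v, w1) by rewrite xpair_eqE eqxx.
  by rewrite flips_diag => /orP[] /andP[].
have kg w : keeps B g w w.
  have /c : (v0, w) != (v1, w) by rewrite xpair_eqE eqxx andbT.
  by rewrite flips_diag => /orP[] /andP[].
split.
- apply/mem_GR_closureP=> v v' vv'.
  have /c : (v, w0) != (v', w0) by rewrite xpair_eqE eqxx andbT.
  by rewrite flips_diag kg !andbT.
- apply/mem_GR_closureP=> w w' ww'.
  have /c : (v0, w) != (v0, w') by rewrite xpair_eqE eqxx.
  by rewrite flips_diag kf.
move=> v v' w w'; have [[<- <-] | /c //] := eqVneq (v, w) (v', w').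
by rewrite kf kg.
Qed.

End Product.

(** * Derivation of the three cases *)

Lemma flips_mem_self_paired (V : finType) (A : {group {perm V}}) s :
  s \in A -> (forall u v, flips A s u v) -> all_self_paired A.
Proof.
move=> sA f; apply/all_self_pairedE=> u v.
by rewrite -(Or_orbit_eq (keeps_mem u v sA)) (Or_orbit_eq (f u v)) Or_orbit_refl.
Qed.

Theorem theorem3p15 (V W : finType)
    (A : {group {perm V}}) (B : {group {perm W}})
    (V_nonempty : 0 < #|V|) (W_nonempty : 0 < #|W|)
    (A_neq_I1 : ~ isI 1 A) (B_neq_I1 : ~ isI 1 B) :
  (* the "i.e." of case (i) *)
  (~ DGR (perm_dprod A B) <-> (~ DGR A \/ ~ DGR B)) /\
  (GR (perm_dprod A B) <->
   ~ ((* (i) *)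
      ~ DGR (perm_dprod A B)
      \/ (* (ii) *)
      (GR A /\ all_self_paired A /\ ~ (GR B \/ isI 2 B)
       \/ GR B /\ all_self_paired B /\ ~ (GR A \/ isI 2 A))
      \/ (* (iii) *)
      ((DGR A /\ ~ (GR A \/ isI 2 A)) /\
       (DGR B /\ ~ (GR B \/ isI 2 B)) /\
       [transitive A, on [set: V] | 'P] /\
       [transitive B, on [set: W] | 'P] /\
       (exists2 a, a \in GR_closure A :\: A & pairs_all A a) /\
       (exists2 b, b \in GR_closure B :\: B & pairs_all B b)))).
Proof.
have DP := DGR_prod V_nonempty W_nonempty A_neq_I1 B_neq_I1.
split.
  (* Deciding both memberships turns the negated conjunction into a disjunction. *)
  case: (DGRP A) (DGRP B) => [dA | nA] [dB | nB]; tauto.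
split=> [grAB | nc].
  case=> [|[[[_ [sp nB]] | [_ [sp nA]]] | ]].
  - by apply; apply: (@GR_DGR _ (perm_dprod_group A B)).
  - apply: (nB); left; apply: (GR_prod_self_pairedl V_nonempty W_nonempty grAB sp) => ?.
    by apply: nB; right.
  - apply: (nA); left; apply: (GR_prod_self_pairedr V_nonempty W_nonempty grAB sp) => ?.
    by apply: nA; right.
  case=> _ [_ [tA [tB [[a]]]]]; rewrite in_setD => /andP[aA ac] pa.
  case=> b; rewrite in_setD => /andP[bB bc] pb; case/negP: aA.
  suff /andP[] : (a \in A) && (b \in B) by [].
  (* In case (iii), [(a, b)] flips every pair with both coordinates distinct, and transitivity
     handles the diagonal pairs. *)
  apply: GR_prod_closed => // [v|w|v v' w w' vv' ww'].
  - exact: trans_keeps_diag.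
  - exact: trans_keeps_diag.
  by rewrite !pairs_all_flips ?orbT.
have /DP[dA dB] : DGR (perm_dprod A B).
  by apply/(@DGRP _ (perm_dprod_group A B))/negPn/negP=> /DGRP n; apply: nc; left.
apply/(@GRP _ (perm_dprod_group A B))/subsetP=> s sc.
have [f [g es]] := GR_closure_prod V_nonempty W_nonempty sc.
rewrite {s}es in sc *; rewrite mem_perm_dprod //.
have [fc gc c] := GR_closure_prod_factors V_nonempty W_nonempty A_neq_I1 B_neq_I1 sc.
have [/card_gt0P[v0 _] /card_gt0P[w0 _]] := (V_nonempty, W_nonempty).
have kf v : keeps A f v v by have := c v v w0 w0; rewrite flips_diag => /orP[] /andP[].
have kg w : keeps B g w w by have := c v0 v0 w w; rewrite flips_diag => /orP[] /andP[].
have fg : f \notin A -> forall w w', flips B g w w'.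
  case/not_mem_not_keeps=> // v [v' nk] w w'.
  by have := c v v' w w'; rewrite (negPf nk) => /andP[].
have gf : g \notin B -> forall v v', flips A f v v'.
  case/not_mem_not_keeps=> // w [w' nk] v v'.
  by have := c v v' w w'; rewrite (negPf nk) andbF => /andP[].
(* If both factors lie in their groups there is nothing to prove. If exactly one does, it flips
   everything, so its group has only self-paired Or-orbitals: case (ii). If neither does, both flip
   everything: case (iii). *)
have [fA | fA] := boolP (f \in A); have [gB | gB] //= := boolP (g \in B); case: nc.
- have sp := flips_mem_self_paired fA (gf gB).
  right; left; left; split; first exact: self_paired_GR.
  by split=> //; apply: not_GR_or_I2 gB gc kg.
- have sp := flips_mem_self_paired gB (fg fA).
  right; left; right; split; first exact: self_paired_GR.
  by split=> //; apply: not_GR_or_I2 fA fc kf.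
right; right.
split; first by split=> //; apply: not_GR_or_I2 fA fc kf.
split; first by split=> //; apply: not_GR_or_I2 gB gc kg.
split; first by apply: (@flips_trans _ _ f) => // *; apply: gf.
split; first by apply: (@flips_trans _ _ g) => // *; apply: fg.
split; first by exists f; rewrite ?in_setD ?fA ?fc //; apply: flips_pairs_all => *; apply: gf.
by exists g; rewrite ?in_setD ?gB ?gc //; apply: flips_pairs_all => *; apply: fg.
Qed.
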